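(* Let $A$ be a finite non-empty alphabet, let $\lambda$ be a left-infinite word over $A$ and $\rho$ a right-infinite word over $A$. The set $OG_{\lambda,\rho}=\{og(\lambda_n,\rho_n): n\in\mathbb{N}\}$ is finite if and only if $\lambda={}^{\omega}u\,w_1$ and $\rho=w_2\,u^{\omega}$ for some words $u\in A^+$ and $w_1,w_2\in A^*$.
   Context: $A^*$ is the free monoid (finite words, including the empty word) and $A^+$ the set of non-empty finite words over $A$; $\mathbb{N}=\{0,1,2,\dots\}$. A left-infinite word is a sequence $\cdots a_{-2}a_{-1}a_0$ of letters indexed by $-\mathbb{N}$; a right-infinite word is a sequence $a_0a_1a_2\cdots$ indexed by $\mathbb{N}$. For $u\in A^+$ and $w\in A^*$, ${}^{\omega}u\,w$ denotes the left-infinite word $\cdots uuuw$ and $w\,u^{\omega}$ the right-infinite word $wuuu\cdots$. For $n\in\mathbb{N}$, $\lambda_n$ is the suffix of length $n$ of $\lambda$ and $\rho_n$ is the prefix of length $n$ of $\rho$. For finite words $u,v$ of equal length: $log(u,v)=\min\{n\in\mathbb{N}: ux=x'v \text{ for some } x,x'\in A^n\}$, $rog(u,v)=\min\{n\in\mathbb{N}: xu=vx' \text{ for some } x,x'\in A^n\}$, and $og(u,v)=\min\{log(u,v),rog(u,v)\}$. *)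

(* Defs.v *)
From mathcomp Require Import all_boot.
From mathcomp Require Import classical_sets cardinality.

Set Implicit Arguments.
Unset Strict Implicit.
Unset Printing Implicit Defensive.

Local Open Scope classical_set_scope.

Section Overlap.
Variables (A : finType) (k : nat).
Implicit Types u v : k.-tuple A.

Definition log_gap u v : pred nat := fun n =>
  [exists x : n.-tuple A, exists x' : n.-tuple A, u ++ x == x' ++ v :> seq A].

Definition rog_gap u v : pred nat := fun n =>
  [exists x : n.-tuple A, exists x' : n.-tuple A, x ++ u == v ++ x' :> seq A].

Lemma log_gap_ex u v : exists n, log_gap u v n.
Proof. by exists k; apply/existsP; exists v; apply/existsP; exists u. Qed.

Lemma rog_gap_ex u v : exists n, rog_gap u v n.
Proof. by exists k; apply/existsP; exists v; apply/existsP; exists u. Qed.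

Definition log u v : nat := ex_minn (log_gap_ex u v).
Definition rog u v : nat := ex_minn (rog_gap_ex u v).
Definition og u v : nat := minn (log u v) (rog u v).

End Overlap.

(* The word ... a_{-2} a_{-1} a_0 is the function i |-> a_{-i}: a left-infinite
   word is indexed from its last letter. *)
Definition left_word (A : Type) := nat -> A.

Definition right_word (A : Type) := nat -> A.

Section InfiniteWords.
Variable A : finType.
Implicit Types (lam : left_word A) (rho : right_word A) (w : seq A).

(* rev_ord i has value n - i.+1, so this is a_{-(n-1)} ... a_{-1} a_0. *)
Definition lsuffix lam n : n.-tuple A := [tuple lam (rev_ord i) | i < n].

Definition rprefix rho n : n.-tuple A := [tuple rho i | i < n].

(* A word in A^+ is a k.+1.-tuple. The letter at distance i from the finite end
   of an infinite word is read off the finite word with i.+1 copies of u, which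
   has more than i letters, so the default value of nth is never used. *)
Definition left_omega k (u : k.+1.-tuple A) w : left_word A :=
  fun i => nth (thead u) (rev (flatten (nseq i.+1 (u : seq A)) ++ w)) i.

Definition right_omega w k (u : k.+1.-tuple A) : right_word A :=
  fun i => nth (thead u) (w ++ flatten (nseq i.+1 (u : seq A))) i.

Definition OG lam rho : set nat :=
  range (fun n => og (lsuffix lam n) (rprefix rho n)).

End InfiniteWords.

(* Main.v *)
Require Import Defs.
From mathcomp Require Import all_boot zify.
From mathcomp Require Import boolp classical_sets cardinality.

(** Write l a for the letter of lam at distance a from its end. Both kinds of
    overlap of lam_n and rho_n say that l a = rho b on an antidiagonal
    a + b + 1 = s, away from a margin: s = n - m for a left gap m and
    s = n + m, with a, b >= m, for a right gap m. If og is bounded, the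
    levels s for which this holds with a fixed margin have bounded gaps;
    reflecting in two such levels s < s' gives the period s' - s, so (K+1)! is
    a period of both words beyond the margin when K bounds the gaps, and one
    reflection identifies the two periodic parts. Conversely, periodic tails
    over the same u agree on every antidiagonal in one residue class modulo
    the length of u, which gives bounded right gaps. *)

Definition mirror {A : Type} (lam : left_word A) (rho : right_word A)
    (margin s : nat) : Prop :=
  forall a b, margin <= a -> margin <= b -> (a + b).+1 = s -> lam a = rho b.

Lemma finite_set_natP (X : set nat) :
  finite_set X <-> exists M, forall x, X x -> x <= M.
Proof.
split=> [/finite_seqP [s ->]|[M XM]].
  by exists (\max_(i <- s) i) => x /= xs; apply: leq_bigmax_seq.
by apply: (sub_finite_set _ (finite_II M.+1)) => x /= /XM.
Qed.

(** * Overlap gaps as reflections *)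

Section Gaps.
Variables (A : finType) (lam : left_word A) (rho : right_word A) (n : nat).

Lemma nth_lsuffix x0 i : i < n -> nth x0 (lsuffix lam n) i = lam (n - i.+1).
Proof. by move=> ltin; exact: (nth_mktuple _ x0 (Ordinal ltin)). Qed.

Lemma nth_rprefix x0 i : i < n -> nth x0 (rprefix rho n) i = rho i.
Proof. by move=> ltin; exact: (nth_mktuple _ x0 (Ordinal ltin)). Qed.

Lemma log_gap_mirror m : m < n ->
  log_gap (lsuffix lam n) (rprefix rho n) m -> mirror lam rho 0 (n - m).
Proof.
move=> ltmn /existsP[x /existsP[x' /eqP E]] a b _ _ abE.
have := congr1 (fun s => nth (lam 0) s (m + b)) E.
rewrite !nth_cat !size_tuple ifT ?ifF; try lia.
rewrite nth_lsuffix ?nth_rprefix; try lia.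
have -> : n - (m + b).+1 = a by lia.
by have -> : m + b - m = b by lia.
Qed.

(** A right gap [m] leaves the first [m] letters of [rho] and the last [m] of [lam] unconstrained,
    hence the margin; conversely these letters serve as [x] and [x']. *)
Lemma rog_gap_mirror m : m <= n ->
  rog_gap (lsuffix lam n) (rprefix rho n) m <-> mirror lam rho m (n + m).
Proof.
move=> lemn; split.
  move=> /existsP[x /existsP[x' /eqP E]] a b lema lemb abE.
  case: (ltnP b n) => [ltbn|lenb]; last by lia.
  have := congr1 (fun s => nth (lam 0) s b) E.
  rewrite !nth_cat !size_tuple ifF ?ltbn; last by lia.
  rewrite nth_lsuffix ?nth_rprefix; try lia.
  by have -> : n - (b - m).+1 = a by lia.
move=> H; set u := lsuffix lam n; set v := rprefix rho n.
have szx : size (take m v) == m by rewrite size_takel ?size_tuple.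
have szx' : size (drop (n - m) u) == m by rewrite size_drop size_tuple; lia.
have E : take (n - m) u = drop m v.
  apply: (@eq_from_nth _ (lam 0)) => [|i].
    by rewrite size_drop size_takel !size_tuple ?leq_subr.
  rewrite size_takel ?size_tuple ?leq_subr // => lti.
  rewrite nth_take ?nth_drop ?nth_lsuffix ?nth_rprefix; try lia.
  by apply: H; lia.
apply/existsP; exists (Tuple szx); apply/existsP; exists (Tuple szx') => /=.
by rewrite -{1}(cat_take_drop (n - m) u) E catA cat_take_drop.
Qed.

Lemma og_mirror M : M < n -> og (lsuffix lam n) (rprefix rho n) <= M ->
  exists2 m, m <= M &
    mirror lam rho 0 (n - m) \/ mirror lam rho m (n + m).
Proof.
move=> ltMn; rewrite /og geq_min /log /rog.
case: ex_minnP => m gm _; case: ex_minnP => m' gm' _ /orP[] le.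
  by exists m => //; left; apply: log_gap_mirror => //; lia.
by exists m' => //; right; apply/rog_gap_mirror => //; lia.
Qed.

Lemma mirror_og m : mirror lam rho m (n + m) ->
  og (lsuffix lam n) (rprefix rho n) <= m.
Proof.
move=> H; rewrite /og geq_min; apply/orP; right; rewrite /rog.
case: ex_minnP => r _ minr; case: (leqP m n) => [lemn|ltnm].
  by apply/minr/rog_gap_mirror.
(* The gap [n] is always available: with margin [n], level [n + n] carries no constraint. *)
apply: leq_trans (ltnW ltnm); apply: minr; apply/rog_gap_mirror => // a b; lia.
Qed.

End Gaps.

(** * Letters of eventually periodic words *)

Lemma nth_flatten_nseq (T : Type) (x : T) (u : seq T) j i :
  i < j * size u -> nth x (flatten (nseq j u)) i = nth x u (i %% size u).
Proof.
elim: j i => [|j IH] i //= lti; rewrite nth_cat.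
case: ltnP => [ltiu|leui]; first by rewrite modn_small.
rewrite IH; last by lia.
by rewrite -{2}(subnK leui) modnDr.
Qed.

Lemma nth_cat_flatten_nseq (T : Type) (x : T) (w u : seq T) i : 0 < size u ->
  nth x (w ++ flatten (nseq i.+1 u)) i =
  if i < size w then nth x w i else nth x u ((i - size w) %% size u).
Proof.
move=> u0; rewrite nth_cat; case: ltnP => // lewi.
by rewrite nth_flatten_nseq //; nia.
Qed.

Lemma right_omegaE (A : finType) k (u : k.+1.-tuple A) w i :
  right_omega w u i = if i < size w then nth (thead u) w i
                      else nth (thead u) u ((i - size w) %% k.+1).
Proof. by rewrite /right_omega nth_cat_flatten_nseq size_tuple. Qed.

Lemma left_omegaE (A : finType) k (u : k.+1.-tuple A) w i :
  left_omega u w i = if i < size w then nth (thead u) (rev w) i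
                     else nth (thead u) (rev u) ((i - size w) %% k.+1).
Proof.
rewrite /left_omega rev_cat rev_flatten map_nseq rev_nseq.
by rewrite nth_cat_flatten_nseq !size_rev size_tuple.
Qed.

Section EventuallyPeriodic.
Variables (T : Type) (f : nat -> T) (t p : nat).
Hypothesis fp : forall i, t <= i -> f (i + p) = f i.

Lemma eventually_periodicM j i : t <= i -> f (i + j * p) = f i.
Proof.
move=> lei; elim: j => [|j IH]; first by rewrite addn0.
by rewrite mulSnr addnA fp ?IH //; lia.
Qed.

Lemma eventually_periodic_mod i : t <= i -> f i = f (t + (i - t) %% p).
Proof.
move=> lei; rewrite -[RHS](eventually_periodicM ((i - t) %/ p)) ?leq_addr //.
by congr f; rewrite -addnA [_ %% _ + _]addnC -divn_eq subnKC.
Qed.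

End EventuallyPeriodic.

(** * From periodic tails to bounded gaps *)

Lemma omega_mirror (A : finType) k (u : k.+1.-tuple A) (w1 w2 : seq A) s :
  k.+1 %| (s - size w1 - size w2) ->
  mirror (left_omega u w1) (right_omega w2 u) (size w1 + size w2) s.
Proof.
move=> dvd a b lea leb abs; rewrite left_omegaE right_omegaE !ifF; try lia.
rewrite nth_rev size_tuple ?ltn_pmod //; congr nth.
have {dvd} : k.+1 %| ((a - size w1) + (b - size w2)).+1.
  suff -> : ((a - size w1) + (b - size w2)).+1 = s - size w1 - size w2 by [].
  by lia.
move: (a - _) (b - _) => c d /dvdnP[q qE].
have := divn_eq c k.+1; have := divn_eq d k.+1.
have := ltn_pmod c (ltn0Sn k); have := ltn_pmod d (ltn0Sn k).
move: (c %/ _) (d %/ _) (c %% _) (d %% _) => c' d' i j ltj lti dE cE.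
(* [(i + j).+1] is a multiple of [k.+1] lying strictly between 0 and [2 * k.+1]. *)
suff : (i + j).+1 = k.+1 by lia.
have E : (i + j).+1 = (q - c' - d') * k.+1.
  by rewrite !mulnBl -qE dE cE; lia.
case: (q - c' - d') E => [|[|x]] E; nia.
Qed.

Lemma omega_og_bound (A : finType) k (u : k.+1.-tuple A) (w1 w2 : seq A) n :
  og (lsuffix (left_omega u w1) n) (rprefix (right_omega w2 u) n)
    <= size w1 + size w2 + k.+1.
Proof.
(* As [k] is -1 modulo [k.+1], [r] is the residue of [-n]: the gap [W + r] puts the level in the
   right class. *)
set W := size w1 + size w2; set r := (n * k) %% k.+1.
have ltr : r < k.+1 by rewrite ltn_pmod.
apply: (@leq_trans (W + r)); last by lia.
apply: mirror_og => a b lea leb abE.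
apply: (omega_mirror _ _ _ _ _ (a + b).+1) => //; try (rewrite -/W; lia).
have -> : (a + b).+1 - size w1 - size w2 = n + r by rewrite /W in abE *; lia.
by rewrite /dvdn /r modnDmr -mulnS modnMl.
Qed.

(** * From bounded gaps to periodic tails *)

Section Syndetic.
Variables (A : Type) (lam : left_word A) (rho : right_word A) (M K : nat).
Hypothesis syn : forall N, exists2 s, N <= s <= N + K & mirror lam rho M s.

Let syndetic_pair N : exists s s',
  [/\ N <= s, s < s' <= s + K.+1, mirror lam rho M s & mirror lam rho M s'].
Proof.
have [s /andP[leNs _] ms] := syn N; have [s' les' ms'] := syn s.+1.
by exists s, s'; split=> //; lia.
Qed.

(** The difference [d] of two nearby levels varies with the pair; the factorial is a common multiple
    of all its possible values. *)
Lemma syndetic_left_periodic a : M <= a -> lam (a + (K.+1)`!) = lam a.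
Proof.
move=> leMa.
(* Levels this far out let the shift by [d] be iterated from [a] up to the factorial without meeting
   the margin of [rho]. *)
have [s [s' [leNs lts ms ms']]] := syndetic_pair (a + M + (K.+1)`!).
have [d s'E] : exists d, s' = s + d by exists (s' - s); lia.
have /dvdnP[q qE] : d %| (K.+1)`! by apply: dvdn_fact; lia.
have per c : M <= c -> c + M < s -> lam (c + d) = lam c.
  by move=> leMc les; rewrite (ms c (s - c.+1)) ?(ms' _ (s - c.+1)) //; lia.
have iter j : a + j * d + M < s' -> lam (a + j * d) = lam a.
  elim: j => [|j IH]; first by rewrite addn0.
  by rewrite mulSnr addnA => le; rewrite per ?IH //; lia.
by rewrite qE iter //; lia.
Qed.

Lemma syndetic_right_periodic b : M <= b -> rho (b + (K.+1)`!) = rho b.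
Proof.
move=> leMb; have [s les ms] := syn (b.+1 + M + (K.+1)`!).
(* Reflection in one distant level carries the period of [lam] over to [rho]. *)
rewrite -(ms (s - b.+1) b) -?(ms (s - b.+1 - (K.+1)`!) _); try lia.
rewrite -[in RHS](@subnK (K.+1)`! (s - b.+1)) ?syndetic_left_periodic //; lia.
Qed.

End Syndetic.

Lemma syndetic_omega (A : finType) (lam : left_word A) (rho : right_word A)
    M K :
  (forall N, exists2 s, N <= s <= N + K & mirror lam rho M s) ->
  exists (k : nat) (u : k.+1.-tuple A) (w1 w2 : seq A),
    lam = left_omega u w1 /\ rho = right_omega w2 u.
Proof.
move=> syn; have lamP := syndetic_left_periodic _ _ _ _ _ syn.
have rhoP := syndetic_right_periodic _ _ _ _ _ syn.
have: 0 < (K.+1)`! by rewrite fact_gt0.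
case: (_`!) lamP rhoP => // k lamP rhoP _.
have [s les ms] := syn (2 * M + k.+1).
(* Reflection in [s] sends positions [t], ..., [t + k] of [lam] to [M + k], ..., [M] of [rho], so
   both tails repeat the same [u]. *)
pose t := s - M - k.+1.
exists k, [tuple rho (M + i) | i < k.+1], (rev (mkseq lam t)), (mkseq rho M).
set u := mktuple _.
have uE i : i < k.+1 -> nth (thead u) u i = rho (M + i).
  by move=> lti; exact: (nth_mktuple _ (thead u) (Ordinal lti)).
split; apply/funext => i.
  rewrite left_omegaE size_rev size_mkseq revK.
  case: ltnP => [lti|leti]; first by rewrite nth_mkseq.
  have ltr := ltn_pmod (i - t) (ltn0Sn k).
  rewrite nth_rev size_tuple // uE; last by lia.
  rewrite (@eventually_periodic_mod _ lam t k.+1) //.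
    by apply: ms; rewrite /t; lia.
  by move=> j lej; apply: lamP; rewrite /t in lej; lia.
rewrite right_omegaE size_mkseq.
case: ltnP => [lti|leti]; first by rewrite nth_mkseq.
by rewrite uE ?ltn_pmod // (@eventually_periodic_mod _ rho M k.+1).
Qed.

Theorem theorem3p6 (A : finType) (hA : 0 < #|A|)
    (lam : left_word A) (rho : right_word A) :
  finite_set (OG lam rho) <->
  exists (k : nat) (u : k.+1.-tuple A) (w1 w2 : seq A),
    lam = left_omega u w1 /\ rho = right_omega w2 u.
Proof.
rewrite finite_set_natP; split.
  (* For words of length [n = (N + M).+1], the levels [n - m] and [n + m] with [m <= M] lie between
     [N] and [N + (2 * M).+1]. *)
  move=> [M ogM]; apply: (@syndetic_omega _ _ _ M (2 * M).+1) => N.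
  have leog : og (lsuffix lam (N + M).+1) (rprefix rho (N + M).+1) <= M.
    by apply: ogM; exists (N + M).+1.
  have [|m lem] := og_mirror _ _ _ _ _ _ leog; first by lia.
  case=> ms; [exists ((N + M).+1 - m)|exists ((N + M).+1 + m)]; try lia.
    by move=> a b _ _; apply: ms.
  by move=> a b lea leb; apply: ms; lia.
move=> [k [u [w1 [w2 [-> ->]]]]]; exists (size w1 + size w2 + k.+1).
by move=> _ [n _ <-]; apply: omega_og_bound.
Qed.
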